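(* Let $S$ be a strictly proper scoring rule and suppose there exists $\pi_m\in\Lambda$ which is least favorable with respect to the prior disclosure game with score $S$. Then a prior $\pi\in\Lambda$ is least favorable for the disclosure game if and only if it is a Bayesimax prior (for $S$). Consequently, every minimax decision rule in the disclosure game is a Bayes rule under every Bayesimax prior.
   Context: Setting. $(\Omega,\mathcal{T})$ is a standard Borel parameter space; $\{P_\theta:\theta\in\Omega\}$ is a family of probability measures on a measurable space $(\mathcal{X},\mathcal{A})$ dominated by a $\sigma$-finite measure $\lambda$, with densities $p_\theta=dP_\theta/d\lambda$. $\Lambda$ is a set of probability measures on $(\Omega,\mathcal{T})$ (priors), with the weak topology and its Borel $\sigma$-algebra. For a prior $\pi$, the prior predictive $m^\pi$ is the measure on $\mathcal{X}$ with $\frac{dm^\pi}{d\lambda}(x)=\int_\Omega p_\theta(x)\,d\pi(\theta)$, and $\Pi_x^\pi$ is the Bayes posterior on $\Omega$ given $X=x$, assumed to exist for $m^\pi$-almost all $x$ and to be measurable in $x$. Scores. A scoring rule $S$ assigns to each probability measure $Q$ on $(\Omega,\mathcal{T})$ a measurable function $S(Q,\cdot):\Omega\to\mathbb{R}\cup\{-\infty\}$. It is proper if $\mathbb{E}_{Y\sim P}[S(P,Y)]\ge\mathbb{E}_{Y\sim P}[S(Q,Y)]$ for all $P,Q$, and strictly proper if in addition equality implies $Q=P$. Prior disclosure game. A decision rule is a measurable map $\delta:\mathcal{X}\to\Lambda$. The loss is $\ell_S(\theta,x,a)=-S(\Pi_x^a,\theta)$ for $a\in\Lambda$. The frequentist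 risk is $\mathcal{R}_S(\delta,\theta)=\mathbb{E}_{X\sim P_\theta}[\ell_S(\theta,X,\delta(X))]$. The Bayes risk under $\pi\in\Lambda$ is $R_S(\delta,\pi)=\mathbb{E}_{\Theta\sim\pi}[\mathcal{R}_S(\delta,\Theta)]$. The minimum Bayes risk is $r_S(\pi)=\inf_\delta R_S(\delta,\pi)$ over all decision rules, and $\delta$ is a Bayes rule under $\pi$ if $R_S(\delta,\pi)=r_S(\pi)$. A rule $\delta^M$ is minimax if $\sup_{\theta\in\Omega}\mathcal{R}_S(\delta^M,\theta)=\inf_\delta\sup_{\theta\in\Omega}\mathcal{R}_S(\delta,\theta)$. A prior $\pi$ is least favorable if it admits a Bayes rule $\delta_\pi$ such that $\mathcal{R}_S(\delta_\pi,\theta)\le r_S(\pi)$ for all $\theta\in\Omega$. A Bayesimax prior (for $S$) is any maximizer $\pi^\star\in\arg\max_{\pi\in\Lambda}r_S(\pi)$. Conventions. The posteriors $\Pi_x^a$ appearing in these definitions are assumed to exist, and the expectations defining the risks are assumed measurable and well defined. *)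

(* Defs.v *)
From mathcomp Require Import all_boot all_order all_algebra.
From mathcomp Require Import all_classical all_reals all_analysis measurable_realfun.

Set Implicit Arguments.
Unset Strict Implicit.
Unset Printing Implicit Defensive.

Import Order.TTheory GRing.Theory Num.Theory.
Import numFieldNormedType.Exports.

Local Open Scope classical_set_scope.
Local Open Scope ring_scope.
Local Open Scope ereal_scope.

Definition polish (R : realType) (T : topologicalType) : Prop :=
  (exists2 D : set T, countable D & dense D) /\
  exists (M : metricType R) (f : T -> M) (g : M -> T),
    [/\ forall F : set_system M, ProperFilter F -> cauchy F ->
          exists l : M, F --> l,
        continuous f, continuous g, cancel f g & cancel g f].

(* [tau] is a Polish topology whose Borel sigma-algebra is the sigma-algebra of
   [Omega]: the existence of such a [tau] says that [Omega] is standard Borel.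
   The weak topology on priors refers to [tau], although its Borel
   sigma-algebra does not depend on the choice. *)
Definition standard_borel_topology (R : realType) d (Omega : measurableType d)
    (tau : Topological Omega) : Prop :=
  polish R (Topological.Pack tau) /\
  (@measurable d Omega = <<s @open (Topological.Pack tau) >>).

Section Game.
Context {R : realType} {dO dX : measure_display}.
Context {Omega : measurableType dO} {X : measurableType dX}.

(* MathComp-Analysis measures are functions on all subsets, constrained only on
   the measurable ones, so equality of measures is not Leibniz equality. *)
Definition eq_measure (P Q : probability Omega R) : Prop :=
  forall A, measurable A -> P A = Q A.

(* The expectation of [f] is not of the form oo - oo, for which
   [\int[mu]_x f x] returns -oo by convention. *)
Definition expectation_defined d (T : measurableType d)
    (mu : probability T R) (f : T -> \bar R) : Prop :=
  measurable_fun setT f /\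
  (\int[mu]_x (f^\+ x) < +oo \/ \int[mu]_x (f^\- x) < +oo).

Definition scoring_rule (S : probability Omega R -> Omega -> \bar R) : Prop :=
  [/\ forall Q, measurable_fun setT (S Q),
      forall Q y, S Q y != +oo
    & forall P Q, eq_measure P Q -> S P = S Q].

Definition proper (S : probability Omega R -> Omega -> \bar R) : Prop :=
  (forall P Q : probability Omega R, expectation_defined P (S Q)) /\
  (forall P Q : probability Omega R,
     \int[P]_y S P y >= \int[P]_y S Q y).

Definition strictly_proper (S : probability Omega R -> Omega -> \bar R) : Prop :=
  proper S /\
  (forall P Q : probability Omega R,
     \int[P]_y S P y = \int[P]_y S Q y -> eq_measure Q P).

Variable Lambda : set (probability Omega R).

(* The coarsest topology on [Lambda] for which a |-> \int f da is continuous
   for every bounded [tau]-continuous [f : Omega -> R]. *)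
Definition weak_topology (tau : Topological Omega) : topologicalType :=
  sup_topology
    (fun f : {f : Omega -> R |
         continuous (f : Topological.Pack tau -> R) /\ bounded_fun f} =>
       Topological.class
         (initial_topology
            (fun a : Lambda => (\int[val a]_y sval f y)%R))).

Definition decision_rule (tau : Topological Omega) (delta : X -> Lambda) : Prop :=
  forall B : set Lambda, <<s @open (weak_topology tau) >> B ->
    measurable (delta @^-1` B).

Section Model.
Variables (lambda : {sigma_finite_measure set X -> \bar R}).
Variables (P : Omega -> probability X R) (p : Omega -> X -> R).

Definition densities : Prop :=
  forall theta, [/\ forall x, (0 <= p theta x)%R,
    measurable_fun setT (p theta)
  & forall A, measurable A -> P theta A = \int[lambda]_(x in A) (p theta x)%:E].

Definition predictive_density (pi : Lambda) (x : X) : \bar R :=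
  \int[val pi]_theta (p theta x)%:E.

Definition prior_predictive (pi : Lambda) (A : set X) : \bar R :=
  \int[lambda]_(x in A) predictive_density pi x.

(* What is needed for [prior_predictive pi] to be a measure. *)
Definition predictive_defined : Prop :=
  (forall x, measurable_fun setT (fun theta => p theta x)) /\
  (forall pi : Lambda, measurable_fun setT (predictive_density pi)).

(* As the left-hand side is a probability, Bayes's formula can only hold at [x]
   if [predictive_density pi x] is neither 0 nor +oo. *)
Definition posterior (Post : Lambda -> X -> probability Omega R) : Prop :=
  forall pi : Lambda,
    (forall B, measurable B -> measurable_fun setT (fun x => Post pi x B)) /\
    (\forall x \ae prior_predictive pi, forall B, measurable B ->
       Post pi x B =
       (\int[val pi]_(theta in B) (p theta x)%:E) / predictive_density pi x).

End Model.

Section Risk.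
Variables (tau : Topological Omega) (P : Omega -> probability X R).
Variables (Post : Lambda -> X -> probability Omega R).
Variables (S : probability Omega R -> Omega -> \bar R).

Definition loss (theta : Omega) (x : X) (a : Lambda) : \bar R :=
  - S (Post a x) theta.

Definition risk (delta : X -> Lambda) (theta : Omega) : \bar R :=
  \int[P theta]_x loss theta x (delta x).

Definition bayes_risk (delta : X -> Lambda) (pi : Lambda) : \bar R :=
  \int[val pi]_theta risk delta theta.

Definition risks_defined : Prop :=
  forall delta, decision_rule tau delta ->
    (forall theta,
       expectation_defined (P theta) (fun x => loss theta x (delta x))) /\
    (forall pi : Lambda, expectation_defined (val pi) (risk delta)).

Definition min_bayes_risk (pi : Lambda) : \bar R :=
  ereal_inf [set bayes_risk delta pi | delta in decision_rule tau].

Definition bayes_rule (pi : Lambda) (delta : X -> Lambda) : Prop :=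
  decision_rule tau delta /\ bayes_risk delta pi = min_bayes_risk pi.

Definition max_risk (delta : X -> Lambda) : \bar R :=
  ereal_sup (range (risk delta)).

Definition minimax (delta : X -> Lambda) : Prop :=
  decision_rule tau delta /\
  max_risk delta = ereal_inf [set max_risk delta' | delta' in decision_rule tau].

Definition least_favorable (pi : Lambda) : Prop :=
  exists delta, bayes_rule pi delta /\
    forall theta, risk delta theta <= min_bayes_risk pi.

Definition bayesimax (pi : Lambda) : Prop :=
  forall pi' : Lambda, min_bayes_risk pi' <= min_bayes_risk pi.

End Risk.
End Game.

(* Main.v *)
Require Import Defs.
From mathcomp Require Import all_boot all_order all_algebra.
From mathcomp Require Import all_classical all_reals all_analysis measurable_realfun.

Set Implicit Arguments.
Unset Strict Implicit.

Import Order.TTheory.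

Local Open Scope classical_set_scope.
Local Open Scope ring_scope.

(** Only one half of a minimax theorem is at work. If a rule [delta] has risk at
    most [c] at every parameter, then averaging gives Bayes risk at most [c]
    under every prior, so that the minimum Bayes risk of every prior is at most
    [c] ([bayes_risk_le], [min_bayes_risk_le]).

    Let [pi_m] be least favorable, with Bayes rule [delta_m], and let [V] be its
    minimum Bayes risk. Since the risk of [delta_m] is at most [V] everywhere,
    [V] bounds all minimum Bayes risks: [pi_m] is Bayesimax
    ([least_favorable_bayesimax]), and every Bayesimax prior [pi] attains the
    same value [V]. Hence [delta_m] has risk at most the minimum Bayes risk of
    [pi] everywhere. That makes it a Bayes rule under [pi] as well
    ([bayes_rule_of_bounded_risk]), and it witnesses that [pi] is least
    favorable. A minimax rule has a maximal risk no larger than that of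
    [delta_m], hence at most [V], and the same argument makes it a Bayes rule
    under [pi]. *)

(** The positive part increases and the negative part decreases, and both
    integrals are monotone on nonnegative functions. Risks may be infinite, and
    an integral of the form oo - oo does not spoil the comparison, because its
    value is -oo: for [f] this is below everything, and for [g] it forces the
    negative part of [f] to have integral +oo, so that the integral of [f] is
    -oo too. *)
Lemma le_integral_pointwise (R : realType) (d : measure_display)
    (T : measurableType d) (mu : {measure set T -> \bar R})
    (f g : T -> \bar R)
    (mf : measurable_fun setT f) (mg : measurable_fun setT g)
    (fg : forall x, (f x <= g x)%E) :
  (\int[mu]_x f x <= \int[mu]_x g x)%E.
Proof.
rewrite integralE [leRHS]integralE leeB//; apply: ge0_le_integral => //;
  try exact: measurable_funepos; try exact: measurable_funeneg.
- by move=> x _; apply: (funepos_le (D := setT)); rewrite ?inE.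
- by move=> x _; apply: (funeneg_le (D := setT)); rewrite ?inE.
Qed.

Lemma bayes_risk_le (R : realType) (dO dX : measure_display)
    (Omega : measurableType dO) (X : measurableType dX)
    (P : Omega -> probability X R) (Lambda : set (probability Omega R))
    (Post : Lambda -> X -> probability Omega R)
    (S : probability Omega R -> Omega -> \bar R)
    (delta : X -> Lambda) (hm : measurable_fun setT (risk P Post S delta))
    (c : \bar R)
    (hc : forall theta, (risk P Post S delta theta <= c)%E) (pi : Lambda) :
  (bayes_risk P Post S delta pi <= c)%E.
Proof.
apply: (@le_trans _ _ (\int[val pi]_theta cst c theta)%E).
  exact: le_integral_pointwise.
rewrite integral_cst//.
by rewrite [X in (c * X)%E](probability_setT (val pi)) mule1.
Qed.

Lemma measurable_risk (R : realType) (dO dX : measure_display)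
    (Omega : measurableType dO) (X : measurableType dX)
    (tau : Topological Omega)
    (P : Omega -> probability X R) (Lambda : set (probability Omega R))
    (Post : Lambda -> X -> probability Omega R)
    (S : probability Omega R -> Omega -> \bar R)
    (hrisk : risks_defined tau P Post S)
    (delta : X -> Lambda) (hdelta : decision_rule tau delta) (pi : Lambda) :
  measurable_fun setT (risk P Post S delta).
Proof. by have [_ /(_ pi)[]] := hrisk _ hdelta. Qed.

Lemma min_bayes_risk_le (R : realType) (dO dX : measure_display)
    (Omega : measurableType dO) (X : measurableType dX)
    (tau : Topological Omega)
    (P : Omega -> probability X R) (Lambda : set (probability Omega R))
    (Post : Lambda -> X -> probability Omega R)
    (S : probability Omega R -> Omega -> \bar R)
    (hrisk : risks_defined tau P Post S)
    (delta : X -> Lambda) (hdelta : decision_rule tau delta) (c : \bar R)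
    (hc : forall theta, (risk P Post S delta theta <= c)%E) (pi : Lambda) :
  (min_bayes_risk tau P Post S pi <= c)%E.
Proof.
apply: ge_ereal_inf; exists (bayes_risk P Post S delta pi).
  by exists delta.
by apply: bayes_risk_le => //; exact: (measurable_risk hrisk hdelta).
Qed.

Lemma bayes_rule_of_bounded_risk (R : realType) (dO dX : measure_display)
    (Omega : measurableType dO) (X : measurableType dX)
    (tau : Topological Omega)
    (P : Omega -> probability X R) (Lambda : set (probability Omega R))
    (Post : Lambda -> X -> probability Omega R)
    (S : probability Omega R -> Omega -> \bar R)
    (hrisk : risks_defined tau P Post S)
    (delta : X -> Lambda) (hdelta : decision_rule tau delta) (pi : Lambda)
    (hle : forall theta,
      (risk P Post S delta theta <= min_bayes_risk tau P Post S pi)%E) :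
  bayes_rule tau P Post S pi delta.
Proof.
split=> //; apply/le_anti; rewrite bayes_risk_le//=; last first.
  exact: (measurable_risk hrisk hdelta).
by apply: ereal_inf_lbound; exists delta.
Qed.

Lemma least_favorable_bayesimax (R : realType) (dO dX : measure_display)
    (Omega : measurableType dO) (X : measurableType dX)
    (tau : Topological Omega)
    (P : Omega -> probability X R) (Lambda : set (probability Omega R))
    (Post : Lambda -> X -> probability Omega R)
    (S : probability Omega R -> Omega -> \bar R)
    (hrisk : risks_defined tau P Post S)
    (pi : Lambda) (hpi : least_favorable tau P Post S pi) :
  bayesimax tau P Post S pi.
Proof.
case: hpi => delta [[hdelta _] hle] pi'.
exact: (min_bayes_risk_le hrisk hdelta).
Qed.

Theorem proposition3p7 (R : realType) (dO dX : measure_display)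
    (Omega : measurableType dO) (X : measurableType dX)
    (tau : Topological Omega) (htau : standard_borel_topology R tau)
    (lambda : {sigma_finite_measure set X -> \bar R})
    (P : Omega -> probability X R) (p : Omega -> X -> R)
    (hp : densities lambda P p)
    (Lambda : set (probability Omega R))
    (hpred : predictive_defined Lambda p)
    (Post : Lambda -> X -> probability Omega R)
    (hPost : posterior lambda p Post)
    (S : probability Omega R -> Omega -> \bar R)
    (hS : scoring_rule S) (hSp : strictly_proper S)
    (hrisk : risks_defined tau P Post S)
    (hlf : exists pi_m : Lambda, least_favorable tau P Post S pi_m) :
  (forall pi : Lambda,
     least_favorable tau P Post S pi <-> bayesimax tau P Post S pi) /\
  (forall deltaM : X -> Lambda, minimax tau P Post S deltaM ->
     forall pi : Lambda, bayesimax tau P Post S pi ->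
       bayes_rule tau P Post S pi deltaM).
Proof.
case: hlf => pi_m [delta_m [[hdm _] hm]].
have hle pi : bayesimax tau P Post S pi -> forall theta,
    (risk P Post S delta_m theta <= min_bayes_risk tau P Post S pi)%E.
  by move=> hpi theta; exact: le_trans (hm theta) (hpi pi_m).
split=> [pi|deltaM [hdM hM] pi hpi].
- split=> [|hpi]; first exact: least_favorable_bayesimax.
  exists delta_m; split; last exact: hle.
  by apply: bayes_rule_of_bounded_risk => //; exact: hle.
- apply: bayes_rule_of_bounded_risk => // theta.
  apply: (@le_trans _ _ (max_risk P Post S deltaM)).
    by apply: ereal_sup_ubound; exists theta.
  rewrite hM; apply: ge_ereal_inf; exists (max_risk P Post S delta_m).
    by exists delta_m.
  by apply: ge_ereal_sup => _ [theta' _ <-]; exact: hle.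
Qed.
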